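(* A real Banach space $X$ has the uniform Daugavet property if and only if every ultrapower $X^{\mathcal U}$ has the Daugavet property, in which case every ultrapower $X^{\mathcal U}$ even has the uniform Daugavet property.
   Context: All Banach spaces are real; $S(X)$ is the unit sphere of $X$. A Banach space $X$ has the Daugavet property if $\|\mathrm{Id}+T\|=1+\|T\|$ for every bounded rank-$1$ linear operator $T: X\to X$. For $x\in S(X)$ and $\varepsilon>0$ put $l^+(x,\varepsilon)=\{y\in X: \|y\|\le 1+\varepsilon,\ \|x+y\|>2-\varepsilon\}$. For $A\subset X$, $\mathrm{conv}_n(A)$ is the set of all convex combinations of $n$-point collections of elements of $A$. Define $D_X(\varepsilon)=\inf\{n\in\mathbb{N}: \mathrm{conv}_n(l^+(x,\varepsilon))\supset S(X)\ \text{for all } x\in S(X)\}$, with $\inf\emptyset=\infty$. $X$ has the uniform Daugavet property if $D_X(\varepsilon)<\infty$ for every $\varepsilon>0$. For an ultrafilter $\mathcal U$ on a set $\mathcal I$, the ultrapower $X^{\mathcal U}$ is the quotient of the space of bounded families $(x_i)_{i\in\mathcal I}$ in $X$ by the subspace of families with $\lim_{\mathcal U}\|x_i\|=0$, with norm $\|(x_i)\|=\lim_{\mathcal U}\|x_i\|$. *)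

(* Defs.v *)
From HB Require Import structures.
From mathcomp Require Import all_boot all_order all_algebra.
From mathcomp Require Import generic_quotient ring_quotient ring lra.
From mathcomp Require Import all_classical all_reals all_analysis.

Set Implicit Arguments.
Unset Strict Implicit.
Unset Printing Implicit Defensive.

Import Order.TTheory GRing.Theory Num.Theory.
Import numFieldNormedType.Exports.

Local Open Scope classical_set_scope.
Local Open Scope ring_scope.

Section bounded_families.
Context (R : realType) (X : completeNormedModType R) (I : Type).

Definition bounded_fam : {pred I -> X} := fun f => `[< bounded_fun f >].

Lemma bounded_famP (f : I -> X) :
  reflect (exists2 M, 0 <= M & forall i, `|f i| <= M) (f \in bounded_fam).
Proof.
apply: (iffP (asboolP _)) => /= [/pinfty_ex_gt0[M M0 fM]|[M M0 fM]].
  by exists M; [exact: ltW|move=> i; exact: fM].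
rewrite /bounded_near; near=> N => i _ /=.
by rewrite (le_trans (fM i))//; near: N; apply: nbhs_pinfty_ge; rewrite num_real.
Unshelve. all: by end_near. Qed.

Lemma bounded_fam_submod_closed : submod_closed bounded_fam.
Proof.
split; first by apply/bounded_famP; exists 0 => // i; rewrite normr0.
move=> a f g /bounded_famP[M M0 fM] /bounded_famP[N N0 gN].
apply/bounded_famP; exists (`|a| * M + N); first by rewrite addr_ge0// mulr_ge0.
move=> i; rewrite (le_trans (ler_normD _ _))// lerD//.
by rewrite normrZ ler_wpM2l.
Qed.

HB.instance Definition _ :=
  GRing.isSubmodClosed.Build R (I -> X) bounded_fam bounded_fam_submod_closed.

Record bfamily := BFamily {
  bfamily_fun :> I -> X ;
  bfamily_bounded : bfamily_fun \in bounded_fam }.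

HB.instance Definition _ := [isSub for bfamily_fun].
HB.instance Definition _ := [Choice of bfamily by <:].
HB.instance Definition _ := [SubChoice_isSubLmodule of bfamily by <:].

Lemma bfamilyP (f : bfamily) : exists2 M, 0 <= M & forall i, `|f i| <= M.
Proof. exact/bounded_famP/bfamily_bounded. Qed.

End bounded_families.

Section ultrapower.
Context (R : realType) (X : completeNormedModType R) (I : Type).
Context (U : set_system I) (FU : UltraFilter U).
Implicit Types f g : bfamily X I.

Lemma ultra_cvg_norm f : cvg ((fun i => `|f i|) @ U).
Proof.
have [M M0 fM] := bfamilyP f.
have [|l [_ clu]] := @segment_compact R 0 M ((fun i => `|f i|) @ U) _.
  apply: (@filterE _ U) => i /=; rewrite in_itv/= normr_ge0; exact: fM.
apply/cvg_ex; exists l => V Vl.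
have [//|UV] := in_ultra_setVsetC ((fun i => `|f i|) @^-1` V) FU.
by have [x [nVx Vx]] := clu (~` V) V UV Vl.
Qed.

Definition null_family : {pred bfamily X I} :=
  fun f => `[< (fun i => `|f i|) @ U --> (0 : R) >].

Lemma null_familyP f :
  reflect ((fun i => `|f i|) @ U --> (0 : R)) (f \in null_family).
Proof. exact: asboolP. Qed.

Lemma null_family_submod_closed : submod_closed null_family.
Proof.
split.
  apply/null_familyP; under eq_fun do rewrite normr0; exact: cvg_cst.
move=> a f g /null_familyP f0 /null_familyP g0; apply/null_familyP.
apply: (@squeeze_cvgr _ _ _ _ (cst 0) (fun i => `|a| * `|f i| + `|g i|)).
- apply: nearW => i /=; rewrite normr_ge0/= -normrZ.
  exact: ler_normD.
- exact: cvg_cst.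
- rewrite -(addr0 (0 : R)) -[X in X + _](mulr0 `|a|).
  by apply: cvgD => //; apply: cvgM => //; exact: cvg_cst.
Qed.

HB.instance Definition _ := GRing.isSubmodClosed.Build R (bfamily X I)
  null_family null_family_submod_closed.

Definition ultrapower : Type := Quotient.quot null_family.

HB.instance Definition _ := Choice.on ultrapower.
HB.instance Definition _ := GRing.Zmodule.on ultrapower.

Definition uclass f : ultrapower := \pi_(Quotient.quot null_family)%qT f.

Definition urepr (x : ultrapower) : bfamily X I := repr x.

Lemma ureprK : cancel urepr uclass.
Proof. exact: reprK. Qed.

Lemma uclassP f g : uclass f = uclass g <-> f - g \in null_family.
Proof. by rewrite Quotient.idealrBE; split=> [fg|/eqP//]; exact/eqP. Qed.

Lemma uclassB f g : uclass (f - g) = uclass f - uclass g.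
Proof. exact: (raddfB (\pi_(Quotient.quot null_family)%qT)). Qed.

Lemma uclassD f g : uclass (f + g) = uclass f + uclass g.
Proof. exact: (raddfD (\pi_(Quotient.quot null_family)%qT)). Qed.

Definition uscale (a : R) (x : ultrapower) : ultrapower :=
  uclass (a *: urepr x).

Lemma uclassZ a f : uclass (a *: f) = uscale a (uclass f).
Proof.
apply/uclassP; rewrite -scalerBr rpredZ//; apply/uclassP.
by rewrite ureprK.
Qed.

Fact uscaleA a b x : uscale a (uscale b x) = uscale (a * b) x.
Proof. by rewrite -[x]ureprK -!uclassZ scalerA. Qed.

Fact uscale1 : left_id 1 uscale.
Proof. by move=> x; rewrite -[x]ureprK -uclassZ scale1r. Qed.

Fact uscaleDr : right_distributive uscale +%R.
Proof.
by move=> a x y; rewrite -[x]ureprK -[y]ureprK -uclassD -!uclassZ -uclassD scalerDr.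
Qed.

Fact uscaleDl x : {morph uscale^~ x : a b / a + b}.
Proof. by move=> a b; rewrite -[x]ureprK -!uclassZ -uclassD scalerDl. Qed.

HB.instance Definition _ := GRing.Zmodule_isLmodule.Build R ultrapower
  uscaleA uscale1 uscaleDr uscaleDl.

(* The limit exists by [ultra_cvg_norm]; [norm_uclass] below shows that it does
   not depend on the chosen representative. *)
Definition unorm (x : ultrapower) : R := lim ((fun i => `|urepr x i|) @ U).

Lemma unorm_class f : unorm (uclass f) = lim ((fun i => `|f i|) @ U).
Proof.
have /uclassP/null_familyP fg0 : uclass (urepr (uclass f)) = uclass f.
  exact: ureprK.
have cf := @ultra_cvg_norm f.
apply: (cvg_lim (@Rhausdorff R)).
set g := urepr _ in fg0 *.
have -> : (fun i => `|g i|) = (fun i => `|f i| + (`|g i| - `|f i|)).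
  by apply/funext => i; rewrite addrC subrK.
rewrite -[X in _ --> X]addr0; apply: cvgD => //.
apply/norm_cvg0P.
apply: (@squeeze_cvgr _ _ _ _ (cst 0) (fun i => `|(g - f) i|)) => //.
- by apply: nearW => i /=; rewrite normr_ge0/=; exact: ler_dist_dist.
- exact: cvg_cst.
Qed.

Fact unormD x y : unorm (x + y) <= unorm x + unorm y.
Proof.
rewrite -[x]ureprK -[y]ureprK -uclassD !unorm_class.
have [cx cy] := (@ultra_cvg_norm (urepr x), @ultra_cvg_norm (urepr y)).
rewrite -subr_le0.
apply: (cvgr_to_le (cvgB (@ultra_cvg_norm (urepr x + urepr y)) (cvgD cx cy))).
apply: nearW => i /=.
by rewrite subr_le0; exact: ler_normD.
Qed.

Fact unormZ a x : unorm (a *: x) = `|a| * unorm x.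
Proof.
have -> : a *: x = uclass (a *: urepr x) by [].
rewrite unorm_class; apply: cvg_lim => //.
under eq_fun do rewrite normrZ.
by apply: cvgM; [exact: cvg_cst|exact: ultra_cvg_norm].
Qed.

Fact unorm_eq0 x : unorm x = 0 -> x = 0.
Proof.
move=> x0; rewrite -[x]ureprK -[RHS](subrr (uclass 0)) -uclassB subr0.
apply/uclassP; rewrite subr0; apply/null_familyP.
by rewrite -x0; exact: ultra_cvg_norm.
Qed.

HB.instance Definition _ := Lmodule_isNormed.Build R ultrapower
  unormD unormZ unorm_eq0.

Lemma unormE x : `|x| = unorm x.
Proof. by []. Qed.

Lemma norm_uclass f : `|uclass f| = lim ((fun i => `|f i|) @ U).
Proof. by rewrite unormE unorm_class. Qed.

Lemma uclass_lift x e : `|x| < e ->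
  exists2 f, uclass f = x & forall i, `|f i| <= e.
Proof.
move=> xe; have e0 : 0 <= e by rewrite ltW// (le_lt_trans _ xe).
pose r := urepr x; pose d i := if `|r i| <= e then r i else 0.
have de i : `|d i| <= e by rewrite /d; case: ifP; rewrite ?normr0.
have db : d \in @bounded_fam R X I by apply/bounded_famP; exists e.
exists (BFamily db) => //.
rewrite -[RHS]ureprK; apply/uclassP/null_familyP.
have Ur : U [set i | `|r i| <= e].
  have := @ultra_cvg_norm r; rewrite -/(unorm x) -unormE.
  move=> /cvgr_le; apply; exact: xe.
apply: cvg_near_cst; apply: filterS Ur => i re.
have -> : (BFamily db - urepr x) i = d i - r i by [].
by rewrite /d re subrr normr0.
Qed.

Lemma uclass_norm_le f e : (forall i, `|f i| <= e) -> `|uclass f| <= e.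
Proof.
move=> fe; rewrite norm_uclass; apply: limr_le; first exact: ultra_cvg_norm.
exact: nearW.
Qed.

End ultrapower.

Section completeness.
Context (R : realType) (X : completeNormedModType R).

Let e n : R := geometric 2 2^-1 n.

Let e_ge0 n : 0 <= e n.
Proof. by rewrite mulr_ge0// exprn_ge0// invr_ge0. Qed.

Let e_sum n p : (n <= p)%N -> \sum_(n <= k < p) e k <= 2 * e n.
Proof.
move=> np; have -> : \sum_(n <= k < p) e k = 2 * e n - 2 * e p.
  rewrite -(opprB (2 * e p)) -(telescope_sumr (fun k => 2 * e k))// -sumrN.
  by apply: eq_bigr => k _; rewrite /e /= exprS; field.
by rewrite lerBlDr lerDl mulr_ge0.
Qed.

Let series_cvg (u : nat -> X) : (forall k, `|u k| <= e k) -> cvgn (series u).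
Proof.
move=> ue; apply: normed_cvg; apply: (series_le_cvg _ _ ue) => //.
by apply: is_cvg_geometric_series; rewrite ger0_norm ?invr_ge0// invf_lt1// ltr1n.
Qed.

Let series_tail (u : nat -> X) n : (forall k, `|u k| <= e k) ->
  `|limn (series u) - series u n| <= 2 * e n.
Proof.
move=> ue; have cu := series_cvg ue.
have : (fun m => `|series u m - series u n|) @ \oo -->
    `|limn (series u) - series u n|.
  by apply: cvg_norm; apply: cvgB => //; exact: cvg_cst.
move=> /cvgr_to_le; apply.
near=> m; have nm : (n <= m)%N by near: m; exact: nbhs_infty_ge.
rewrite sub_series_geq// (le_trans (ler_norm_sum _ _ _))//.
by rewrite (le_trans _ (e_sum nm))// ler_sum.
Unshelve. all: by end_near. Qed.

Context (I : Type) (U : set_system I) (FU : UltraFilter U).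

Lemma ultrapower_complete (F : set_system (ultrapower X FU)) :
  ProperFilter F -> cauchy F -> cvg F.
Proof.
move=> FF /cauchyP Fc.
have eps_gt0 n : 0 < 2^-1 ^+ n :> R by rewrite exprn_gt0// invr_gt0.
have /choice[a aF] : forall n, exists a, F (ball a (2^-1 ^+ n)).
  by move=> n; exact: Fc.
have da n : `|a n.+1 - a n| < e n.
  have [x [/= xn xSn]] := filter_ex (filterI (aF n) (aF n.+1)).
  rewrite -(subrK x (a n.+1)) -addrA (le_lt_trans (ler_normD _ _))//.
  move: xn xSn; rewrite -ball_normE /ball_/= => xn xSn.
  rewrite distrC in xn; have := ltrD xSn xn; move/lt_le_trans; apply.
  by rewrite /e /= exprS; have := eps_gt0 n; lra.
have /choice[d dP] n : exists d : bfamily X I,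
    uclass FU d = a n.+1 - a n /\ forall i, `|d i| <= e n.
  by have [d] := uclass_lift (da n); exists d.
have de i k : `|d k i| <= e k by have [_] := dP k.
pose b0 := urepr (a 0%N).
pose s i := b0 i + limn (series (fun k => d k i)).
have sb : s \in @bounded_fam R X I.
  have [M M0 b0M] := bfamilyP b0.
  apply/bounded_famP; exists (M + 2 * e 0); first by rewrite addr_ge0// mulr_ge0.
  move=> i; rewrite (le_trans (ler_normD _ _))// lerD//.
  by have := series_tail 0 (de i); rewrite /series/= big_geq// subr0.
pose b n := b0 + \sum_(0 <= k < n) d k.
have ab n : uclass FU (b n) = a n.
  rewrite /b; elim: n => [|n IHn]; first by rewrite big_geq// addr0 ureprK.
  by rewrite big_nat_recr//= addrA uclassD IHn (dP n).1 addrC subrK.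
have bE n i : b n i = b0 i + series (fun k => d k i) n.
  rewrite /b /series/=; elim: n => [|n IHn]; first by rewrite !big_geq// !addr0.
  by rewrite !big_nat_recr//= !addrA -IHn.
have sa n : `|uclass FU (BFamily sb) - a n| <= 2 * e n.
  rewrite -ab -uclassB; apply: uclass_norm_le => i.
  have -> : (BFamily sb - b n) i = s i - b n i by [].
  by rewrite bE opprD addrACA subrr add0r; exact: series_tail.
apply/cvg_ex; exists (uclass FU (BFamily sb)).
apply/cvgrPdist_lt => eps eps0.
have lt1 : `|2^-1 : R| < 1 by rewrite ger0_norm ?invr_ge0// invf_lt1// ltr1n.
have [n /= nlt] := filter_ex (cvgr_lt _ (cvg_geometric (5 : R) lt1) eps eps0).
apply: filterS (aF n) => x; rewrite -ball_normE /ball_/= => xn.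
rewrite -(subrK (a n) (uclass _ _)) -addrA (le_lt_trans (ler_normD _ _))//.
rewrite (le_lt_trans _ nlt)// (le_trans (lerD (sa n) (ltW xn)))//.
by rewrite /e /=; lra.
Qed.

HB.instance Definition _ :=
  Uniform_isComplete.Build (ultrapower X FU) ultrapower_complete.

End completeness.

Section daugavet.
Context (R : realType).
Implicit Types X : completeNormedModType R.

(* The operator norm of a bounded linear map; [sup] takes a junk value on
   unbounded sets. *)
Definition opnorm X (T : X -> X) : R :=
  sup [set `|T x| | x in [set x | `|x| <= 1]].

(* Rank exactly 1: the zero operator is excluded. *)
Definition rank_one X (T : {linear X -> X}) :=
  exists2 e : X, e != 0 & range T = [set a *: e | a in setT].

Definition daugavet X := forall T : {linear X -> X},
  bounded_fun_norm T -> rank_one T -> opnorm (idfun \+ T) = 1 + opnorm T.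

Definition unit_sphere X : set X := [set x | `|x| = 1].
Arguments unit_sphere X : clear implicits.

Definition lplus X (x : X) (eps : R) : set X :=
  [set y | `|y| <= 1 + eps /\ 2 - eps < `|x + y|].

Definition conv_n X (n : nat) (A : set X) : set X :=
  [set z | exists (t : 'I_n -> R) (a : 'I_n -> X),
    [/\ forall k, 0 <= t k, \sum_k t k = 1, forall k, A (a k)
      & z = \sum_k t k *: a k]].

(* [n = 0] is allowed; as [conv_n 0 A] is empty, it only belongs to the set for
   the zero space. The infimum of the empty set is [+oo]. *)
Definition daugavet_num X (eps : R) : \bar R :=
  ereal_inf [set n%:R%:E | n in [set n : nat |
    forall x : X, unit_sphere X x -> unit_sphere X `<=` conv_n n (lplus x eps)]].

Definition uniform_daugavet X :=
  forall eps : R, 0 < eps -> (daugavet_num X eps < +oo)%E.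

End daugavet.

(* Main.v *)
Require Import Defs.
From HB Require Import structures.
From mathcomp Require Import all_boot all_order all_algebra.
From mathcomp Require Import lra.
From mathcomp Require Import all_classical all_reals all_analysis.

(** Both directions rest on a local description of the two properties in terms
    of the sets [lplus x eps].

    The uniform property asks that every unit vector be an exact combination
    of at most [n] points of [lplus x eps], with [n] independent of [x]. Such a
    combination splits coordinatewise along an ultrafilter: the weights live in
    the compact interval [0, 1] and the points in a fixed ball, so the weights
    converge and the points define elements of the ultrapower. Hence the
    uniform property passes to ultrapowers
    ([uniform_daugavet_ultrapower]). It implies the Daugavet property
    ([uniform_daugavet_daugavet]): for [T = f(.) e] with [|e| = 1] choose a unit
    vector [y] with [f y] close to [|T|] and write it as a combination of points
    of [lplus e eps]; one of these points, say [a], has [f a] at least [f y],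
    and since [|e + a|] is nearly [2], so is [|a + f(a) e|] nearly
    [1 + f(a)].

    For the converse, the Daugavet property implies, by the Hahn-Banach theorem,
    that every unit vector is a limit of convex combinations of points of
    [lplus x eps] ([daugavet_closure_conv]); [lplus] tolerates small
    translations, so in an ultrapower of [X] a combination that is only close to
    [y] can be lifted to [X] and translated there into exact combinations of
    almost all coordinates of [y], all with the same number [n] of points
    ([near_conv_lplus]). If [X] failed the uniform property, there would be
    for each [n] a pair [x_n], [y_n] of unit vectors violating it with [n]
    points; the ultrapower along a free ultrafilter on the integers, applied to
    these two sequences, gives a single [n] that works for arbitrarily large
    indices, a contradiction.

    The Hahn-Banach theorem is used in this form: a sublinear functional
    dominates a linear one ([hahn_banach]). It is proved by showing that a
    minimal sublinear functional is linear. *)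

Set Implicit Arguments.
Unset Strict Implicit.
Unset Printing Implicit Defensive.

Import Order.TTheory GRing.Theory Num.Theory.
Import numFieldNormedType.Exports.

Local Open Scope classical_set_scope.
Local Open Scope ring_scope.

(** * Sublinear functionals and the Hahn-Banach theorem *)

Section sublinear.
Context (R : realType) (V : lmodType R).
Implicit Types (p q : V -> R) (v w : V).

(** Homogeneity is stated as an inequality; applied to [a] and to its inverse it
    gives the equality. *)
Definition sublinear p :=
  (forall v w, p (v + w) <= p v + p w) /\
  (forall a v, 0 < a -> p (a *: v) <= a * p v).

Lemma sublinear0 p : sublinear p -> p 0 = 0.
Proof.
move=> [_ pZ]; have := pZ 2 0; have := pZ 2^-1 0.
by rewrite !scaler0 => /(_ ltac:(lra)) ? /(_ ltac:(lra)) ?; lra.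
Qed.

Lemma sublinear_opp p v : sublinear p -> - p (- v) <= p v.
Proof.
by move=> sp; have [pD _] := sp; have := pD v (- v); rewrite subrr sublinear0//; lra.
Qed.

(** The infimum of the values [p (v + k) - s] over a convex cone of pairs
    [(k, s)] is again sublinear because the cone is closed under addition and
    scaling, and it is finite because [s <= p k] bounds these values below by
    [- p (- v)]. The pair [(0, 0)] shows that the new functional lies below
    [p], and the pair [(k, s)] that its value at [- k] is at most [- s]: thus
    this construction forces prescribed inequalities on a smaller functional. *)
Lemma sublinear_inf_cone p (K : V -> R -> Prop) : sublinear p ->
    K 0 0 ->
    (forall k s k' s', K k s -> K k' s' -> K (k + k') (s + s')) ->
    (forall a k s, 0 < a -> K k s -> K (a *: k) (a * s)) ->
    (forall k s, K k s -> s <= p k) ->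
  exists2 q, sublinear q & forall v k s, K k s -> q v <= p (v + k) - s.
Proof.
move=> sp K0 KD KZ Kp; have [pD pZ] := sp.
pose E v := [set r | exists k s, K k s /\ r = p (v + k) - s].
have E0 v : E v !=set0 by exists (p (v + 0) - 0), 0, 0.
have Elb v : lbound (E v) (- p (- v)).
  move=> _ [k [s [Kks ->]]].
  by have := pD (- v) (v + k); rewrite addKr; have := Kp _ _ Kks; lra.
have qle v k s : K k s -> inf (E v) <= p (v + k) - s.
  by move=> Kks; apply: ge_inf; [exists (- p (- v))|exists k, s].
exists (fun v => inf (E v)) => //; split=> [v w|a v a0].
  rewrite -lerBlDr; apply: lb_le_inf => // _ [k [s [Kks ->]]].
  rewrite lerBlDr -lerBlDl; apply: lb_le_inf => // _ [k' [s' [Kks' ->]]].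
  rewrite lerBlDl (le_trans (qle _ _ _ (KD _ _ _ _ Kks Kks')))//.
  by rewrite addrACA; have := pD (v + k) (w + k'); lra.
rewrite mulrC -ler_pdivrMr//; apply: lb_le_inf => // _ [k [s [Kks ->]]].
rewrite ler_pdivrMr//.
rewrite (le_trans (qle _ _ _ (KZ _ _ _ a0 Kks)))// -scalerDr.
by rewrite mulrBl mulrC (mulrC s) lerB// mulrC pZ.
Qed.

(** Subadditivity survives because two members of the chain can be replaced by
    the smaller one. *)
Lemma sublinear_inf_chain p (A : set (V -> R)) :
    (forall q, A q -> sublinear q) -> A p ->
    (forall q q', A q -> A q' ->
      (forall v, q v <= q' v) \/ (forall v, q' v <= q v)) ->
  exists2 m, sublinear m & forall q v, A q -> m v <= q v.
Proof.
move=> sA Ap Atot.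
pose E v := [set q v | q in A].
have E0 v : E v !=set0 by exists (p v), p.
have Elb v : has_lbound (E v).
  exists (- p (- v)) => _ [q Aq <-].
  have [qp|pq] := Atot _ _ Aq Ap.
    by have := sublinear_opp v (sA _ Aq); have := qp (- v); lra.
  by have := sublinear_opp v (sA _ Ap); have := pq v; lra.
have mle q v : A q -> inf (E v) <= q v by move=> Aq; apply: ge_inf => //; exists q.
exists (fun v => inf (E v)) => //; split=> [v w|a v a0].
  rewrite -lerBlDr; apply: lb_le_inf => // _ [q Aq <-].
  rewrite lerBlDr -lerBlDl; apply: lb_le_inf => // _ [q' Aq' <-].
  rewrite lerBlDl; have [qq'|q'q] := Atot _ _ Aq Aq'.
    rewrite (le_trans (mle _ _ Aq))// (le_trans ((sA _ Aq).1 _ _))//.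
    by rewrite lerD2l.
  rewrite (le_trans (mle _ _ Aq'))// (le_trans ((sA _ Aq').1 _ _))//.
  by rewrite lerD2r.
rewrite mulrC -ler_pdivrMr//; apply: lb_le_inf => // _ [q Aq <-].
by rewrite ler_pdivrMr// (le_trans (mle _ _ Aq))// mulrC (sA _ Aq).2.
Qed.

(** By Zorn's lemma there is a minimal sublinear [m] below [p]. For a fixed [w],
    lowering [m] along the ray of the pairs [(t *: w, t * m w)] gives a sublinear
    functional, which by minimality is [m] again; the pair with [t = 1] then says
    that [m v <= m (v + w) - m w], so that [m] is additive, hence linear. *)
Lemma hahn_banach p : sublinear p ->
  exists f : {scalar V}, forall v, f v <= p v.
Proof.
move=> sp.
pose T := {q | sublinear q /\ forall v, q v <= p v}.
pose below (s t : T) : bool := `[< forall v, sval t v <= sval s v >].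
have [[m [sm mp]] mmin] : exists m : T, premaximal below m.
  apply: (@ZL_preorder T (exist _ p (conj sp (fun v => lexx (p v))))).
  - by move=> s; apply/asboolP.
  - move=> r s t /asboolP sr /asboolP ts; apply/asboolP => v.
    exact: le_trans (ts v) (sr v).
  move=> A Atot; have [[t0 At0]|A0] := pselect (exists t, A t); last first.
    exists (exist _ p (conj sp (fun v => lexx (p v)))) => s As.
    by exfalso; apply: A0; exists s.
  have [|||m sm mle] := @sublinear_inf_chain (sval t0) [set sval t | t in A].
  - by move=> _ [t _ <-]; exact: (svalP t).1.
  - by exists t0.
  - move=> _ _ [s As <-] [t At <-].
    by have [/asboolP|/asboolP] := Atot _ _ As At; [right|left].
  have mp v : m v <= p v.
    by apply: le_trans (mle _ v _) ((svalP t0).2 v); exists t0.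
  exists (exist _ m (conj sm mp)) => s As; apply/asboolP => v /=.
  by apply: mle; exists s.
have {}mmin q : sublinear q -> (forall v, q v <= m v) -> forall v, m v <= q v.
  move=> sq qm; have qp v := le_trans (qm v) (mp v).
  have h := mmin (exist _ q (conj sq qp)).
  by apply/asboolP/h/asboolP.
have [mD mZ] := sm.
have mDE v w : m (v + w) = m v + m w.
  apply/eqP; rewrite eq_le mD/=.
  pose K k s := exists2 t, 0 <= t & k = t *: w /\ s = t * m w.
  have [||||q sq qle] := @sublinear_inf_cone m K sm.
  - by exists 0; rewrite // scale0r mul0r.
  - move=> _ _ _ _ [t t0 [-> ->]] [t' t'0 [-> ->]].
    by exists (t + t'); rewrite ?addr_ge0// scalerDl mulrDl.
  - move=> a _ _ a0 [t t0 [-> ->]].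
    by exists (a * t); rewrite ?mulr_ge0 ?(ltW a0)// scalerA mulrA.
  - move=> _ _ [t + [-> ->]]; rewrite le0r => /orP[/eqP ->|t0].
      by rewrite mul0r scale0r sublinear0.
    have := mZ t^-1 (t *: w); rewrite invr_gt0 => /(_ t0).
    by rewrite scalerK ?gt_eqF// ler_pdivlMl.
  have qm u : q u <= m u.
    have -> : m u = m (u + 0) - 0 by rewrite addr0 subr0.
    by apply: qle; exists 0; rewrite // scale0r mul0r.
  have := mmin q sq qm v; suff : q v <= m (v + w) - m w by lra.
  by apply: qle; exists 1; rewrite // scale1r mul1r.
have mN v : m (- v) = - m v.
  by apply/eqP; rewrite -addr_eq0 -mDE addNr sublinear0.
have mZpos a v : 0 < a -> m (a *: v) = a * m v.
  move=> a0; apply/eqP; rewrite eq_le mZ//=.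
  have := mZ a (- v) a0; rewrite scalerN !mN; lra.
have ml : scalar m.
  move=> a v w; rewrite mDE; congr (_ + _).
  have [a0|a0|<-] := ltgtP 0 a; first exact: mZpos.
    apply: oppr_inj; rewrite -mN -scaleNr mZpos ?oppr_gt0//.
    by rewrite mulNr.
  by rewrite scale0r mul0r sublinear0.
pose f : {scalar V} := HB.pack m (GRing.isLinear.Build _ _ _ _ m ml).
by exists f.
Qed.

End sublinear.

(** * Convex combinations and separation *)

Section convex.
Context (R : realType) (X : completeNormedModType R).
Implicit Types (A : set X) (x y z : X).

Lemma conv_n_subset n m A : (0 < n)%N -> (n <= m)%N -> conv_n n A `<=` conv_n m A.
Proof.
move=> n0 /subnKC <- z [t [a [t0 t1 Aa ->]]].
exists (fun k => if fintype.split k is inl i then t i else 0).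
exists (fun k => if fintype.split k is inl i then a i else a (Ordinal n0)).
split=> [k|||].
- by case: fintype.split.
- rewrite big_split_ord/= [X in _ + X]big1 ?addr0 => [|i _].
    by rewrite -t1; apply: eq_bigr => i _; rewrite (unsplitK (inl i)).
  by rewrite (unsplitK (inr i)).
- by move=> k; case: fintype.split.
- rewrite big_split_ord/= [X in _ + X]big1 ?addr0 => [|i _].
    by apply: eq_bigr => i _; rewrite (unsplitK (inl i)).
  by rewrite (unsplitK (inr i)) scale0r.
Qed.

Lemma conv_n_gt0 n A z : conv_n n A z -> (0 < n)%N.
Proof.
move=> [t [a [_ t1 _ _]]]; case: n t a t1 => // t _.
by rewrite big_ord0 => /esym/eqP; rewrite oner_eq0.
Qed.

Lemma sublinear_norm : sublinear (fun v : X => `|v|).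
Proof.
by split=> [v w|a v a0]; [exact: ler_normD|rewrite normrZ gtr0_norm].
Qed.

(** Lower the norm along the cone generated by the pairs [(y - a, d)] with [a] in
    [A]. The hypothesis, rescaled, says that the norm dominates this cone, and a
    linear functional below the result satisfies [f (a - y) <= - d]. *)
Lemma separation A y (d : R) :
    (forall n z, conv_n n A z -> d <= `|y - z|) ->
  exists2 f : {scalar X}, (forall v, `|f v| <= `|v|) &
    (forall a, A a -> f a + d <= f y).
Proof.
move=> dA.
pose cone (k : X) s := exists n (t : 'I_n -> R) (a : 'I_n -> X),
  [/\ forall i, 0 <= t i, forall i, A (a i), k = \sum_i t i *: (y - a i)
    & s = (\sum_i t i) * d].
have [||||q sq qle] := sublinear_inf_cone (K := cone) sublinear_norm.
- exists 0%N, (fun=> 0), (fun=> 0).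
  by rewrite !big_ord0 mul0r; split=> //; case.
- move=> _ _ _ _ [n [t [a [t0 Aa -> ->]]]] [n' [t' [a' [t'0 Aa' -> ->]]]].
  exists (n + n')%N.
  exists (fun k => match fintype.split k with inl i => t i | inr j => t' j end).
  exists (fun k => match fintype.split k with inl i => a i | inr j => a' j end).
  split=> [k|k||].
  + by case: fintype.split.
  + by case: fintype.split.
  + rewrite big_split_ord/=; congr (_ + _); apply: eq_bigr => i _.
      by rewrite (unsplitK (inl i)).
    by rewrite (unsplitK (inr i)).
  + rewrite big_split_ord/= mulrDl; congr (_ * _ + _ * _); apply: eq_bigr => i _.
      by rewrite (unsplitK (inl i)).
    by rewrite (unsplitK (inr i)).
- move=> c _ _ c0 [n [t [a [t0 Aa -> ->]]]].
  exists n, (fun i => c * t i), a; split=> // [i||].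
  + by rewrite mulr_ge0// ltW.
  + by rewrite scaler_sumr; apply: eq_bigr => i _; rewrite scalerA.
  + by rewrite mulrA mulr_sumr.
- move=> _ _ [n [t [a [t0 Aa -> ->]]]].
  have s0 : 0 <= \sum_i t i by apply: sumr_ge0.
  move: s0; rewrite le0r => /orP[/eqP ->|s0]; first by rewrite mul0r.
  set s := \sum_i t i in s0 *.
  have -> : \sum_i t i *: (y - a i) = s *: (y - \sum_i (s^-1 * t i) *: a i).
    rewrite scalerBr scaler_sumr scaler_suml -sumrB; apply: eq_bigr => i _.
    by rewrite scalerA mulVKf ?gt_eqF// scalerBr.
  rewrite normrZ gtr0_norm// ler_pM2l//; apply: (dA n).
  exists (fun i => s^-1 * t i), a; split=> //.
    by move=> i; rewrite mulr_ge0// invr_ge0 ltW.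
  by rewrite -mulr_sumr mulVf// gt_eqF.
have [f fq] := hahn_banach sq.
have fn v : f v <= `|v|.
  rewrite (le_trans (fq v))// -[leRHS]subr0 -[v in `|v|]addr0; apply: qle.
  exists 0%N, (fun=> 0), (fun=> 0).
  by rewrite !big_ord0 mul0r; split=> //; case.
exists f => [v|a Aa].
  by rewrite ler_norml fn andbT lerNl -linearN -(normrN v).
suff : f (a - y) <= - d by rewrite linearB/=; lra.
rewrite (le_trans (fq _))//.
have -> : - d = `|(a - y) + (y - a)| - d by rewrite addrA subrK subrr normr0 sub0r.
apply: qle; exists 1%N, (fun=> 1), (fun=> a).
by rewrite !big_ord1 scale1r mul1r; split.
Qed.

End convex.

(** * Operator norms and rank-one operators *)

Section operator_norm.
Context (R : realType) (X : completeNormedModType R).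
Implicit Types T : X -> X.

Let has_sup_norm T : bounded_fun_norm T ->
  has_sup [set `|T x| | x in [set x | `|x| <= 1]].
Proof.
move=> /(_ 1)[M TM]; split; first by exists `|T 0|, 0; rewrite //= normr0.
by exists M => _ [x x1 <-]; exact: TM.
Qed.

Lemma opnorm_ge T x : bounded_fun_norm T -> `|x| <= 1 -> `|T x| <= opnorm T.
Proof. by move=> bT x1; apply: (sup_upper_bound (has_sup_norm bT)); exists x. Qed.

Lemma opnorm_le T c : (forall x, `|x| <= 1 -> `|T x| <= c) -> opnorm T <= c.
Proof.
move=> Tc; apply: ge_sup; first by exists `|T 0|, 0; rewrite //= normr0.
by move=> _ [x x1 <-]; exact: Tc.
Qed.

Lemma opnorm_adherent T e : bounded_fun_norm T -> 0 < e ->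
  exists2 x, `|x| <= 1 & opnorm T - e < `|T x|.
Proof.
by move=> bT e0; have [_ [x x1 <-] xe] := sup_adherent e0 (has_sup_norm bT); exists x.
Qed.

Lemma bounded_idD T : bounded_fun_norm T -> bounded_fun_norm (idfun \+ T).
Proof.
move=> bT r; have [M TM] := bT r; exists (r + M) => x xr /=.
by rewrite (le_trans (ler_normD _ _))// lerD// TM.
Qed.

Lemma opnormD_le T : bounded_fun_norm T -> opnorm (idfun \+ T) <= 1 + opnorm T.
Proof.
move=> bT; apply: opnorm_le => x x1 /=.
by rewrite (le_trans (ler_normD _ _))// lerD// opnorm_ge.
Qed.

Lemma norm_normalize (x : X) : x != 0 -> `| `|x|^-1 *: x| = 1.
Proof. by move=> x0; rewrite normrZ normfV normr_id mulVf// normr_eq0. Qed.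

Lemma rank_one_functional (T : {linear X -> X}) : rank_one T ->
  exists2 e : X, `|e| = 1 & exists f : {scalar X}, forall v, T v = f v *: e.
Proof.
move=> [e0 e00 rT]; pose e := `|e0|^-1 *: e0.
have e1 : `|e| = 1 by exact: norm_normalize.
exists e => //.
have /choice[f fT] v : exists a, T v = a *: e.
  have [a _ <-] : [set a *: e0 | a in setT] (T v) by rewrite -rT; exists v.
  by exists (a * `|e0|); rewrite scalerA -mulrA mulfV ?normr_eq0// mulr1.
have eI a b : a *: e = b *: e -> a = b.
  move/eqP; rewrite -subr_eq0 -scalerBl scaler_eq0 subr_eq0 => /orP[/eqP//|].
  by rewrite -normr_eq0 e1 oner_eq0.
have fl : scalar f.
  by move=> a v w; apply: eI; rewrite -fT linearP !fT scalerDl scalerA.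
pose g : {scalar X} := HB.pack f (GRing.isLinear.Build _ _ _ _ f fl).
by exists g.
Qed.

End operator_norm.

(** * The Daugavet property and convex hulls of the sets lplus *)

Section daugavet.
Context (R : realType) (X : completeNormedModType R).
Implicit Types (x y e : X) (eps : R).

Lemma uniform_daugavetP : uniform_daugavet X <->
  forall eps, 0 < eps -> exists n, forall x, unit_sphere x ->
    @unit_sphere R X `<=` conv_n n (lplus x eps).
Proof.
split=> uX eps e0.
  have [_ [n Pn <-] _] := ereal_inf_lt (uX _ e0); by exists n.
have [n Pn] := uX _ e0; rewrite /daugavet_num.
apply: le_lt_trans (ltry n%:R); apply: ereal_inf_lbound; by exists n.
Qed.

(** If [e] and [u] are almost aligned, so are [u] and any positive multiple of
    [e]: write [u + s *: e] as [(e + u) - (1 - s) *: e] when [s <= 1] and as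
    [s *: (e + u) - (s - 1) *: u] otherwise. *)
Lemma norm_combination (u e : X) s eps : 0 <= eps -> 0 <= s ->
  `|u| <= 1 + eps -> `|e| = 1 -> 2 - eps < `|e + u| ->
  1 + s - eps * (1 + 2 * s) <= `|u + s *: e|.
Proof.
move=> eps0 s0 u1 e1 ue; have [s1|s1] := lerP s 1.
  have := ler_normB (u + s *: e) (- (1 - s) *: e).
  rewrite scaleNr opprK -addrA -scalerDl addrCA subrr addr0 scale1r addrC.
  rewrite normrN normrZ e1 ger0_norm; nra.
have := ler_normB (u + s *: e) (- (s - 1) *: u).
rewrite scaleNr opprK [u + _]addrC -addrA -[X in _ + (X + _)]scale1r -scalerDl.
rewrite addrCA subrr addr0 -scalerDr normrN !normrZ !ger0_norm; nra.
Qed.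

(** A functional takes on some point of a convex combination at least its value
    at the combination. So some [a] in [lplus e eps] has [c - eps < f a], where
    [c] is the norm of the operator [f(.) e], and [norm_combination] bounds
    [|a + f(a) e|] below. *)
Lemma uniform_daugavet_daugavet : uniform_daugavet X -> daugavet X.
Proof.
move=> /uniform_daugavetP uX T bT rT; apply/eqP; rewrite eq_le opnormD_le//=.
have [e e1 [f fT]] := rank_one_functional rT.
set c := opnorm T.
have c0 : 0 <= c by apply: le_trans (opnorm_ge bT (x := 0) _); rewrite ?normr0.
have TE v : `|T v| = `|f v| by rewrite fT normrZ e1 mulr1.
have fc v : f v <= c * `|v|.
  have [->|v0] := eqVneq v 0; first by rewrite linear0 normr0 mulr0.
  rewrite -ler_pdivrMr ?normr_gt0// mulrC -linearZ/=.
  rewrite (le_trans (ler_norm _))// -TE opnorm_ge// norm_normalize//.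
have key eps : 0 < eps -> eps <= 1 ->
    1 + c <= (1 + eps) * opnorm (idfun \+ T) + (2 + 4 * c) * eps.
  move=> eps0 eps1.
  (* Rescaling [x] to the sphere increases [f x]; when [x] is zero, [c < eps]
     and one of [e], [- e] works. *)
  have [y y1 cy] : exists2 y, `|y| = 1 & c - eps < f y.
    have [x x1] := opnorm_adherent bT eps0.
    wlog fx0 : x x1 / 0 <= f x => [hw|].
      have [/hw|/ltW fx0 cx] := lerP 0 (f x); first exact.
      by apply: (hw (- x)); rewrite ?linearN ?normrN//= oppr_ge0.
    rewrite TE ger0_norm// => cx.
    have [x0|x0] := eqVneq x 0.
      move: cx; rewrite x0 linear0 => cx.
      have [fe|fe] := lerP 0 (f e); first by exists e => //; exact: lt_le_trans fe.
      by exists (- e); rewrite ?normrN// linearN/= (lt_le_trans cx)// oppr_ge0 ltW.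
    exists (`|x|^-1 *: x); first exact: norm_normalize.
    rewrite linearZ/= (lt_le_trans cx)// ler_peMl// invf_ge1// normr_gt0//.
  have [n /(_ e e1 y y1)[t [a [t0 t1 la yE]]]] := uX _ eps0.
  have [k ck] : exists k, c - eps < f (a k).
    apply: contrapT => /forallNP h; move: cy; rewrite ltNge => /negP; apply.
    rewrite yE linear_sum/= -[leRHS]mul1r -t1 mulr_suml; apply: ler_sum => k _.
    by rewrite linearZ/= ler_wpM2l// leNgt; exact/negP/h.
  have [ak eak] := la k.
  have h : `|a k + T (a k)| <= (1 + eps) * opnorm (idfun \+ T).
    have eps1' : 0 < 1 + eps by lra.
    rewrite -ler_pdivrMl// -[(1 + eps)^-1]gtr0_norm ?invr_gt0// -normrZ scalerDr.
    rewrite -linearZ; apply: (opnorm_ge (bounded_idD bT)).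
    by rewrite normrZ gtr0_norm ?invr_gt0// ler_pdivrMl// mulr1.
  apply: le_trans (lerD h (lexx _)).
  rewrite fT; have fac : f (a k) <= c * (1 + eps).
    by rewrite (le_trans (fc _))// ler_wpM2l.
  have [fa0|fa0] := lerP 0 (f (a k)).
    have fa2 : f (a k) <= 2 * c by nra.
    have efa : eps * f (a k) <= eps * (2 * c) by rewrite ler_pM2l.
    have := norm_combination (ltW eps0) fa0 ak e1 eak; lra.
  have := ler_normD e (a k); rewrite e1.
  have := ler_normB (a k + f (a k) *: e) (f (a k) *: e).
  rewrite addrK normrZ e1 mulr1 ltr0_norm//.
  have := mulr_ge0 c0 (ltW eps0); lra.
rewrite leNgt; apply/negP => lt.
set N := opnorm (idfun \+ T) in key lt.
have N0 : 0 <= N.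
  by apply: le_trans (opnorm_ge (bounded_idD bT) (x := 0) _); rewrite ?normr0.
(* Twice the size needed in the denominator keeps the inequality strict. *)
pose eps := Num.min 1 ((1 + c - N) / (2 * (N + 2 + 4 * c))).
have D0 : 0 < 2 * (N + 2 + 4 * c) by lra.
have eps0 : 0 < eps by rewrite lt_min ltr01 divr_gt0//; lra.
have := key eps eps0; rewrite ge_min lexx => /(_ isT).
have : eps <= (1 + c - N) / (2 * (N + 2 + 4 * c)) by rewrite ge_min lexx orbT.
by rewrite ler_pdivlMr//; nra.
Qed.

(** Otherwise a functional [f] of norm [s <= 1] satisfies [f a + d <= f y] on
    [lplus x eps]. The Daugavet equation for the operator [f(.) x] gives [u] in
    the unit ball with [|u + f(u) x|] close to [1 + s]; then [f u] is close to
    [s], and [u + f(u) x] being [f u] times [x + u] plus [1 - f u] times [u],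
    also [|x + u|] is close to [2]. Thus [u] lies in [lplus x eps], although
    [f u] exceeds [s - d], hence [f y - d]. *)
Lemma daugavet_closure_conv x y eps d : daugavet X ->
    `|x| = 1 -> `|y| = 1 -> 0 < eps -> 0 < d ->
  exists n z, conv_n n (lplus x eps) z /\ `|y - z| < d.
Proof.
move=> dX x1 y1 eps0 d0; apply: contrapT => nz.
have [n z nz'|f f1 fl] := @separation _ _ (lplus x eps) y d.
  by rewrite leNgt; apply/negP => yz; apply: nz; exists n, z.
have Tl : linear (fun v => f v *: x).
  by move=> a v w; rewrite linearP scalerDl scalerA.
pose T : {linear X -> X} := HB.pack (fun v => f v *: x)
  (GRing.isLinear.Build _ _ _ _ (fun v => f v *: x) Tl).
have TE v : `|T v| = `|f v| by rewrite normrZ x1 mulr1.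
have bT : bounded_fun_norm T.
  by move=> r; exists r => v vr; rewrite TE (le_trans (f1 v)).
have lx : lplus x eps x.
  split; first by rewrite x1; lra.
  by rewrite -mulr2n normrMn x1; lra.
(* [f] is not zero, as it separates [x] from [y]. *)
have fxy : f (y - x) != 0.
  rewrite linearB subr_eq0/=; have := fl _ lx; apply: contraL => /eqP ->.
  by rewrite -ltNge; lra.
have rT : rank_one T.
  exists x; first by rewrite -normr_eq0 x1 oner_eq0.
  apply/seteqP; split=> [_ [v _ <-]|_ [a _ <-]]; first by exists (f v).
  exists ((a / f (y - x)) *: (y - x)) => //=.
  by rewrite /T/= linearZ/= divfK.
have TI := dX T bT rT; set s := opnorm T in TI.
have s0 : 0 < s.
  have := opnorm_ge bT (x := `|y - x|^-1 *: (y - x)).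
  rewrite norm_normalize => [|]; last first.
    by apply: contraNneq fxy => ->; rewrite linear0.
  move=> /(_ (lexx _)); apply: lt_le_trans.
  rewrite TE linearZ normr_gt0 mulf_neq0// invr_eq0 normr_eq0.
  by apply: contraNneq fxy => ->; rewrite linear0.
have s1 : s <= 1 by apply: opnorm_le => v v1; rewrite TE (le_trans (f1 v)).
have fs v : `|v| <= 1 -> f v <= s.
  by move=> v1; rewrite (le_trans (ler_norm _))// -TE opnorm_ge.
(* The final estimate multiplies an inequality by [1 - r], which has to be
   nonnegative. *)
have [r [r0 r1 reps]] : exists r, [/\ 0 < r, r <= 1 & r <= eps].
  by exists (Num.min 1 eps); rewrite lt_min ltr01 eps0 !ge_min !lexx orbT.
have [eta [eta_gt0 etad etas]] : exists eta, [/\ 0 < eta, eta <= d & eta <= s * r].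
  exists (Num.min d (s * r)).
  by rewrite lt_min d0 mulr_gt0// !ge_min !lexx orbT.
have [u u1] := opnorm_adherent (bounded_idD bT) eta_gt0.
rewrite TI.
wlog fu0 : u u1 / 0 <= f u => [hw|].
  have [/hw|/ltW fu0 cu] := lerP 0 (f u); first exact.
  apply: (hw (- u)); rewrite ?normrN//.
    by rewrite linearN oppr_ge0.
  by rewrite /= linearN scaleNr -opprD normrN.
rewrite /= => hu.
have fus := fs _ u1.
have fuge : s - eta < f u.
  have := ler_normD u (f u *: x); rewrite normrZ x1 ger0_norm//; lra.
have xu : 2 - r < `|x + u|.
  have := ler_normD (f u *: (x + u)) ((1 - f u) *: u).
  have -> : f u *: (x + u) + (1 - f u) *: u = u + f u *: x.
    by rewrite scalerDr -addrA -scalerDl addrCA subrr addr0 scale1r addrC.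
  rewrite !normrZ !ger0_norm ?subr_ge0//; last by lra.
  move=> le; have lt : s - eta + f u < f u * `|x + u| by nra.
  rewrite ltNge; apply/negP => xu.
  have := ler_wpM2l fu0 xu; have : f u * (1 - r) <= s * (1 - r).
    by rewrite ler_wpM2r// subr_ge0.
  lra.
have := fl u (conj _ (le_lt_trans (lerB (lexx 2) reps) xu)).
have := fs y; rewrite y1 => /(_ (lexx _)).
by move=> ? /(_ ltac:(lra)); lra.
Qed.

End daugavet.

(** * Lifting from and to the ultrapower *)

Section ultrapower_theory.
Context (R : realType) (X : completeNormedModType R) (I : Type).
Context (U : set_system I) (FU : UltraFilter U).
Implicit Types f g : bfamily X I.

Lemma bfamily_sumE n (f : 'I_n -> bfamily X I) i :
  (\sum_k f k) i = \sum_k f k i.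
Proof. by elim/big_ind2 : _ => // g x h y <- <-. Qed.

Lemma uclass_sumZ n (t : 'I_n -> R) (f : 'I_n -> bfamily X I) :
  uclass FU (\sum_k t k *: f k) = \sum_k t k *: uclass FU (f k).
Proof.
apply: (big_ind2 (fun g x => uclass FU g = x)) => [|g x h y <- <-|k _].
- by rewrite -(subrr 0) uclassB subrr.
- exact: uclassD.
- exact: uclassZ.
Qed.

Lemma uclass_norm_ge f c : (forall i, c <= `|f i|) -> c <= `|uclass FU f|.
Proof.
by move=> cf; rewrite norm_uclass; apply: limr_ge; [exact: ultra_cvg_norm|exact: nearW].
Qed.

Lemma near_norm_lt f c : `|uclass FU f| < c -> \forall i \near U, `|f i| < c.
Proof. by rewrite norm_uclass; apply: cvgr_lt; exact: ultra_cvg_norm. Qed.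

Lemma near_norm_gt f c : c < `|uclass FU f| -> \forall i \near U, c < `|f i|.
Proof. by rewrite norm_uclass; apply: cvgr_gt; exact: ultra_cvg_norm. Qed.

(** Almost all coordinates of a representative are nonzero and can be normalized,
    which moves them by [|1 - |r i||]; the others are replaced by one of these
    unit vectors. *)
Lemma uclass_unit (x : ultrapower X FU) : `|x| = 1 ->
  exists2 f, uclass FU f = x & forall i, `|f i| = 1.
Proof.
move=> x1; pose r := urepr x.
have rx : uclass FU r = x by exact: ureprK.
have r1 : (fun i => `|r i|) @ U --> (1 : R).
  by rewrite -x1 -rx norm_uclass; exact: ultra_cvg_norm.
have r0 : \forall i \near U, r i != 0.
  by apply: filterS (cvgr_gt _ r1 _ ltr01) => i; rewrite normr_gt0.
have [i0 ri0] := filter_ex r0.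
pose u i := if r i == 0 then r i0 else r i.
have u0 i : u i != 0 by rewrite /u; case: ifPn.
pose h i := `|u i|^-1 *: u i.
have h1 i : `|h i| = 1 by exact: norm_normalize.
have hb : h \in @bounded_fam R X I by apply/bounded_famP; exists 1 => // i; rewrite h1.
exists (BFamily hb) => //; rewrite -rx; apply/uclassP/null_familyP.
have : (fun i => `|1 - `|r i| |) @ U --> (0 : R).
  rewrite -[X in _ --> X](normr0 R) -(subrr (1 : R)).
  by apply: cvg_norm; apply: cvgB => //; exact: cvg_cst.
apply: cvg_trans; apply: near_eq_cvg; apply: filterS r0 => i ri.
have -> : (BFamily hb - r) i = h i - r i by [].
rewrite /h /u (negbTE ri) -[X in _ *: _ - X]scale1r -scalerBl normrZ.
have rn0 : `|r i| != 0 by rewrite normr_eq0.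
by rewrite -{3}[`|r i|]normr_id -normrM mulrBl mulVf// mul1r.
Qed.

(** A bounded real function is a bounded family in the Banach space [R], where
    the convergence of norms along an ultrafilter is the convergence of the
    values when these are nonnegative. *)
Lemma ultra_cvg_unit_interval (t : I -> R) : (forall i, 0 <= t i <= 1) ->
  exists l : R, t @ U --> l.
Proof.
move=> t01.
have tb : t \in @bounded_fam R R I.
  apply/bounded_famP; exists 1 => // i; have /andP[t0 t1] := t01 i.
  by rewrite ger0_norm.
have /cvg_ex[l tl] := @ultra_cvg_norm R R I U FU (BFamily tb).
exists l; apply: cvg_trans tl; apply: near_eq_cvg; apply: nearW => i /=.
by have /andP[t0 _] := t01 i; rewrite ger0_norm.
Qed.

(** Limits turn strict inequalities into large ones, whence the use of [eps / 2]
    in the coordinates. *)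
Lemma uniform_daugavet_ultrapower :
  uniform_daugavet X -> uniform_daugavet (ultrapower X FU).
Proof.
move=> /uniform_daugavetP uX; apply/uniform_daugavetP => eps eps0.
have eps2 : 0 < eps / 2 by rewrite divr_gt0.
have [n nP] := uX _ eps2; exists n => _ /uclass_unit[x <- x1] _ /uclass_unit[y <- y1].
have /choice[ta taP] i : exists ta : ('I_n -> R) * ('I_n -> X),
    [/\ forall k, 0 <= ta.1 k, \sum_k ta.1 k = 1,
      forall k, lplus (x i) (eps / 2) (ta.2 k) & y i = \sum_k ta.1 k *: ta.2 k].
  by have [t [a ?]] := nP _ (x1 i) _ (y1 i); exists (t, a).
pose t i := (ta i).1; pose a i := (ta i).2.
have t0 i k : 0 <= t i k by have [+ _ _ _] := taP i; exact.
have t1 i : \sum_k t i k = 1 by have [_ + _ _] := taP i; exact.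
have la i k : lplus (x i) (eps / 2) (a i k) by have [_ _ + _] := taP i; exact.
have yE i : y i = \sum_k t i k *: a i k by have [_ _ _ +] := taP i; exact.
have /choice[s ts] k : exists l : R, (t ^~ k) @ U --> l.
  apply: ultra_cvg_unit_interval => i; rewrite t0/= -(t1 i) (bigD1 k)//=.
  by rewrite lerDl sumr_ge0.
have ab k : (a ^~ k) \in @bounded_fam R X I.
  apply/bounded_famP; exists (1 + eps / 2) => [|i]; first by lra.
  by have [] := la i k.
pose b k := BFamily (ab k).
exists s, (fun k => uclass FU (b k)); split.
- move=> k; rewrite -(cvg_lim _ (ts k))//.
  by apply: limr_ge; [apply/cvg_ex; exists (s k)|apply: nearW => i].
- have : (fun i => \sum_k t i k) @ U --> \sum_k s k.
    by apply: (cvg_big add_continuous) => k _.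
  under eq_fun do rewrite t1.
  by move=> /(cvg_lim (@Rhausdorff R)) <-; exact/lim_cst.
- move=> k; split.
    by apply: uclass_norm_le => i; have [+ _] := la i k; move=> /le_trans; apply; lra.
  rewrite -uclassD; apply: (@lt_le_trans _ _ (2 - eps / 2)); first by lra.
  by apply: uclass_norm_ge => i; have [_ /ltW] := la i k.
- rewrite -uclass_sumZ; apply/uclassP/null_familyP.
  apply: (@squeeze_cvgr _ _ _ _ (cst 0)
    (fun i => \sum_k `|t i k - s k| * (1 + eps / 2))).
  + apply: nearW => i; apply/andP; split; first exact: normr_ge0.
    have -> : (y - \sum_k s k *: b k) i = y i - \sum_k s k *: a i k.
      transitivity (y i - (\sum_k s k *: b k) i) => //.
      by rewrite bfamily_sumE.
    rewrite yE -sumrB (le_trans (ler_norm_sum _ _ _))// ler_sum// => k _.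
    by rewrite -scalerBl normrZ ler_wpM2l//; have [] := la i k.
  + exact: cvg_cst.
  + rewrite [X in _ --> X](_ : 0 = \sum_(k < n) 0 * (1 + eps / 2)); last first.
      by rewrite big1// => k _; rewrite mul0r.
    apply: (@cvg_big _ _ _ _ _ add_continuous) => k _.
    apply: cvgM; last exact: cvg_cst.
    by apply/norm_cvg0P; rewrite -(subrr (s k)); apply: cvgB => //; exact: cvg_cst.
Qed.

End ultrapower_theory.

(** * From the ultrapower back to the space *)

Section converse.
Context (R : realType) (X : completeNormedModType R).

(** An approximating combination in the ultrapower lifts to [sum_k t_k b_k]; the
    error [w] is small at almost every coordinate, and translating every [b_k] by
    [w] makes the combination exact there. *)
Lemma near_conv_lplus (I : Type) (U : set_system I) (FU : UltraFilter U)
    (x y : bfamily X I) eps : daugavet (ultrapower X FU) ->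
    (forall i, `|x i| = 1) -> (forall i, `|y i| = 1) -> 0 < eps ->
  exists2 n, (0 < n)%N & \forall i \near U, conv_n n (lplus (x i) eps) (y i).
Proof.
move=> dXU x1 y1 eps0.
have unit_class (f : bfamily X I) : (forall i, `|f i| = 1) -> `|uclass FU f| = 1.
  move=> f1; apply/eqP; rewrite eq_le uclass_norm_le ?uclass_norm_ge//;
  by move=> i; rewrite f1.
have eps4 : 0 < eps / 4 by rewrite divr_gt0.
have [n [z [cz yz]]] :=
  daugavet_closure_conv dXU (unit_class x x1) (unit_class y y1) eps4 eps4.
have n0 := conv_n_gt0 cz; have [t [a [t0 t1 la zE]]] := cz.
have /choice[b bP] k : exists b, uclass FU b = a k /\ forall i, `|b i| <= 1 + eps / 2.
  have [ak _] := la k.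
  have [|b] := @uclass_lift _ _ _ _ FU (a k) (1 + eps / 2); last by exists b.
  by rewrite (le_lt_trans ak)//; lra.
pose w := y - \sum_k t k *: b k.
have wE i : w i = y i - \sum_k t k *: b k i.
  transitivity (y i - (\sum_k t k *: b k) i) => //.
  by rewrite bfamily_sumE.
have nw : \forall i \near U, `|w i| < eps / 4.
  apply: (near_norm_lt (FU := FU)); rewrite uclassB uclass_sumZ.
  by under eq_bigr do rewrite (bP _).1; rewrite -zE.
have nb : \forall i \near U, forall k, 2 - eps / 4 < `|x i + b k i|.
  apply: filter_forall => k; apply: (near_norm_gt (FU := FU) (f := x + b k)).
  by rewrite uclassD (bP k).1; have [] := la k.
exists n => //; apply: filterS2 nw nb => i wi bi.
exists t, (fun k => b k i + w i); split=> // [k|].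
  split; first by have := ler_normD (b k i) (w i); have := (bP k).2 i; lra.
  have := ler_normB (x i + (b k i + w i)) (w i).
  by rewrite addrA addrK; have := bi k; lra.
under eq_bigr do rewrite scalerDr.
by rewrite wE big_split/= -scaler_suml t1 scale1r addrCA subrr addr0.
Qed.

(** As [U] contains every set of large integers, a property of [U]-almost all
    coordinates holds at some index [n >= m], where [conv_n m] is contained in
    [conv_n n]: this contradicts the choice of the [n]-th coordinates. *)
Lemma daugavet_ultrapower_uniform (U : set_system nat) (FU : UltraFilter U) :
  \oo `<=` U -> daugavet (ultrapower X FU) -> uniform_daugavet X.
Proof.
move=> ooU dXU; apply/uniform_daugavetP => eps eps0; apply: contrapT => /forallNP nP.
have /choice[xy xyP] n : exists xy : X * X, [/\ `|xy.1| = 1, `|xy.2| = 1 &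
    ~ conv_n n (lplus xy.1 eps) xy.2].
  apply: contrapT => h; apply: (nP n) => x x1 y y1; apply: contrapT => xy.
  by apply: h; exists (x, y).
have bounded_unit (f : nat -> X) : (forall i, `|f i| = 1) -> f \in @bounded_fam R X nat.
  by move=> f1; apply/bounded_famP; exists 1 => // i; rewrite f1.
have x1 n : `|(xy n).1| = 1 by have [] := xyP n.
have y1 n : `|(xy n).2| = 1 by have [] := xyP n.
have [m m0 Um] := @near_conv_lplus nat U FU (BFamily (bounded_unit _ x1))
  (BFamily (bounded_unit _ y1)) eps dXU x1 y1 eps0.
have [n [mn]] := filter_ex (filterI (ooU _ (nbhs_infty_ge m)) Um).
by move=> /(conv_n_subset m0 mn); have [] := xyP n.
Qed.

End converse.

Theorem corollary6p5 (R : realType) (X : completeNormedModType R) :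
  (uniform_daugavet X <->
     forall (I : Type) (U : set_system I) (FU : UltraFilter U),
       daugavet (ultrapower X FU)) /\
  (uniform_daugavet X ->
     forall (I : Type) (U : set_system I) (FU : UltraFilter U),
       uniform_daugavet (ultrapower X FU)).
Proof.
split; last by move=> uX I U FU; exact: uniform_daugavet_ultrapower.
split=> [uX I U FU|dX].
  exact/uniform_daugavet_daugavet/uniform_daugavet_ultrapower.
have [U [FU ooU]] := ultraFilterLemma (F := \oo) _.
exact: (daugavet_ultrapower_uniform ooU (dX nat U FU)).
Qed.
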